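(* Let $(A, d_1, \ldots, d_N)$ be an AssHDer pair of rank $N$ and let $(M, d_1^M, \ldots, d_N^M)$ be a trivial AssHDer pair of rank $N$ (i.e. the product of $M$ is zero). Then the isomorphism classes of central extensions of $(A, d_1, \ldots, d_N)$ by $(M, d_1^M, \ldots, d_N^M)$ are classified by the second cohomology group $H^2_{\mathrm{AssHDer}}(A, M)$ of the AssHDer pair $A$ with coefficients in the trivial representation $M$. That is, sending a central extension to the cohomology class of the $2$-cocycle $(\psi; \chi_1, \ldots, \chi_N)$ associated with a section induces a bijection from the set of isomorphism classes of central extensions onto $H^2_{\mathrm{AssHDer}}(A, M)$.
   Context: All vector spaces and linear maps are over a field $\mathbb{K}$ of characteristic zero. Algebras are associative, not assumed unital. Fix an integer $N \ge 1$. A higher derivation of rank $N$ on an associative algebra $A$ is a sequence $\{d_1, \ldots, d_N\}$ of linear maps $A \to A$ with $d_k(ab) = \sum_{i+j=k} d_i(a) d_j(b)$ for $1 \le k \le N$, $a,b\in A$, where $i,j\ge 0$ and $d_0 = \mathrm{id}_A$. An AssHDer pair of rank $N$ is a tuple $(A, d_1, \ldots, d_N)$ of an associative algebra and a higher derivation of rank $N$ on it. A morphism $(A, d_1, \ldots, d_N) \to (A', d_1', \ldots, d_N')$ is an algebra morphism $f: A \to A'$ with $d_k' \circ f = f \circ d_k$ for all $1\le k\le N$; it is an isomorphism if $f$ is bijective. A representation of $(A, d_1, \ldots, d_N)$ is a tuple $(M, d_1^M, \ldots, d_N^M)$ where $M$ is an $A$-bimodule and $d_k^M : M \to M$ are linear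 with $d_k^M(am) = \sum_{i+j=k} d_i(a) d_j^M(m)$ and $d_k^M(ma) = \sum_{i+j=k} d_i^M(m) d_j(a)$ for $1\le k \le N$ (with $d_0 = \mathrm{id}_A$, $d_0^M = \mathrm{id}_M$). The trivial representation on a vector space $M$ with linear maps $d_1^M,\ldots,d_N^M$ is the one with $am = 0 = ma$ for all $a \in A$, $m \in M$. Cohomology. For $f \in \mathrm{Hom}(A^{\otimes n}, M)$, $n\ge 1$, $\delta_{\mathrm{Hoch}} f \in \mathrm{Hom}(A^{\otimes n+1}, M)$ is the Hochschild coboundary $(\delta_{\mathrm{Hoch}} f)(a_1, \ldots, a_{n+1}) = a_1 f(a_2, \ldots, a_{n+1}) + \sum_{i=1}^n (-1)^i f(a_1, \ldots, a_i a_{i+1}, \ldots, a_{n+1}) + (-1)^{n+1} f(a_1, \ldots, a_n) a_{n+1}$, and $\delta_k f = \sum_{i_1 + \cdots + i_n = k,\ i_l\ge 0} f \circ (d_{i_1} \otimes \cdots \otimes d_{i_n}) - d_k^M \circ f \in \mathrm{Hom}(A^{\otimes n}, M)$ for $1\le k\le N$. For a tuple $(f_1, \ldots, f_N)$ in $\mathrm{Hom}(A^{\otimes n}, M)$ and $1\le k\le N$, $\delta'_{\mathrm{Hoch}}(f_k)(a_1, \ldots, a_{n+1}) = \sum_{i+j=k,\ i \ge 0,\ j \ge 1} d_i(a_1) f_j(a_2, \ldots, a_{n+1}) + \sum_{i=1}^n (-1)^i f_k(a_1, \ldots, a_i a_{i+1}, \ldots, a_{n+1}) + (-1)^{n+1}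 \sum_{i+j=k,\ i \ge 1,\ j \ge 0} f_i(a_1, \ldots, a_n) d_j(a_{n+1})$. Set $C^0_{\mathrm{AssHDer}}(A,M) = 0$, $C^1_{\mathrm{AssHDer}}(A, M) = \mathrm{Hom}(A, M)$, and $C^n_{\mathrm{AssHDer}}(A, M) = \mathrm{Hom}(A^{\otimes n}, M) \times \mathrm{Hom}(A^{\otimes n-1}, M)^{N}$ for $n \ge 2$. The differential is $\partial f = (\delta_{\mathrm{Hoch}} f; -\delta_1 f, \ldots, -\delta_N f)$ for $f\in C^1$, and $\partial(f; f_1, \ldots, f_N) = (\delta_{\mathrm{Hoch}} f; \delta'_{\mathrm{Hoch}} f_1 + (-1)^n \delta_1 f, \ldots, \delta'_{\mathrm{Hoch}} f_N + (-1)^n \delta_N f)$ for $(f; f_1, \ldots, f_N) \in C^n$, $n \ge 2$. $H^\ast_{\mathrm{AssHDer}}(A, M)$ is the cohomology of this complex. Central extensions. A central extension of $(A, d_1, \ldots, d_N)$ by the trivial AssHDer pair $(M, d_1^M, \ldots, d_N^M)$ is a short exact sequence of AssHDer pairs $0 \to (M, d_1^M, \ldots, d_N^M) \xrightarrow{i} (\widehat{A}, \widehat{d}_1, \ldots, \widehat{d}_N) \xrightarrow{p} (A, d_1, \ldots, d_N) \to 0$ with $i(m) \cdot \widehat{a} = 0 = \widehat{a} \cdot i(m)$ for all $m \in M$, $\widehat{a} \in \widehat{A}$. Two central extensions $(\widehat A, i, p)$ and $(\widehat A', i', p')$ are isomorphic if there is an isomorphism of AssHDer pairs $\eta: \widehat{A}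 \to \widehat{A}'$ with $\eta \circ i = i'$ and $p' \circ \eta = p$. A section of $p$ is a linear map $s : A \to \widehat{A}$ with $p \circ s = \mathrm{id}_A$. Identifying $M$ with $i(M)$, a section $s$ gives maps $\psi : A^{\otimes 2} \to M$, $\psi(a,b) = s(a) \cdot s(b) - s(ab)$, and $\chi_k : A \to M$, $\chi_k(a) = \widehat{d}_k(s(a)) - s(d_k(a))$ for $1\le k\le N$; $(\psi; \chi_1, \ldots, \chi_N)$ is a $2$-cocycle whose cohomology class does not depend on $s$. *)

(* Defs.v *)
From HB Require Import structures.
From mathcomp Require Import all_boot all_order all_algebra.
From mathcomp Require Import all_classical.
From mathcomp Require Import zify.

Set Implicit Arguments.
Unset Strict Implicit.
Unset Printing Implicit Defensive.

Import GRing.Theory.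
Local Open Scope ring_scope.

(* MathComp rings are unital, so associative algebras that need not have a unit
   are given by a vector space of arbitrary dimension and a bilinear product. *)
Record nalgebra (K : fieldType) := NAlgebra {
  nalg_car :> lmodType K;
  nmul : {bilinear nalg_car -> nalg_car -> nalg_car};
  nmulA : associative nmul }.

(* A higher derivation d_1, ..., d_N is stored together with d_0 = id, as a
   family indexed by 'I_N.+1; when only the indices 1, ..., N are meant, they are
   written [lift ord0 k] (with value k.+1) for k : 'I_N. *)
Definition higher_derivation (K : fieldType) (N : nat) (A : nalgebra K)
    (d : 'I_N.+1 -> {linear A -> A}) : Prop :=
  d ord0 =1 id /\
  forall (k : 'I_N.+1) (a b : A),
    d k (nmul A a b) =
    \sum_(i < N.+1) \sum_(j < N.+1 | (i + j == k)%N) nmul A (d i a) (d j b).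

Record asshder (K : fieldType) (N : nat) := AssHDer {
  asshder_alg :> nalgebra K;
  hder : 'I_N.+1 -> {linear asshder_alg -> asshder_alg};
  hderP : higher_derivation hder }.

Record asshder_hom (K : fieldType) (N : nat) (A B : asshder K N) :=
  AssHDerHom {
  hom_fun :> {linear A -> B};
  hom_mul : forall a b, hom_fun (nmul A a b) = nmul B (hom_fun a) (hom_fun b);
  hom_der : forall (k : 'I_N.+1) a, hder B k (hom_fun a) = hom_fun (hder A k a) }.

Record rep (K : fieldType) (N : nat) (A : asshder K N) := Rep {
  rep_car :> lmodType K;
  lact : {bilinear A -> rep_car -> rep_car};
  ract : {bilinear rep_car -> A -> rep_car};
  lactA : forall a b m, lact (nmul A a b) m = lact a (lact b m);
  ractA : forall m a b, ract m (nmul A a b) = ract (ract m a) b;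
  lractA : forall a m b, ract (lact a m) b = lact a (ract m b);
  rep_der : 'I_N.+1 -> {linear rep_car -> rep_car};
  rep_der0 : rep_der ord0 =1 id;
  rep_der_lact : forall (k : 'I_N.+1) a m,
    rep_der k (lact a m) =
    \sum_(i < N.+1) \sum_(j < N.+1 | (i + j == k)%N)
      lact (hder A i a) (rep_der j m);
  rep_der_ract : forall (k : 'I_N.+1) m a,
    rep_der k (ract m a) =
    \sum_(i < N.+1) \sum_(j < N.+1 | (i + j == k)%N)
      ract (rep_der i m) (hder A j a) }.

Section ZeroAction.
Variables (K : fieldType) (U V W : lmodType K).
Definition zero_action (u : U) (v : V) : W := 0.
Lemma zero_action_bilinear :
  bilinear_for (GRing.Scale.Law.clone _ _ *:%R _)
    (GRing.Scale.Law.clone _ _ *:%R _) zero_action.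
Proof. by split=> ? ? ? ? /=; rewrite /zero_action scaler0 addr0. Qed.
HB.instance Definition _ :=
  bilinear_isBilinear.Build K U V W _ _ zero_action zero_action_bilinear.
End ZeroAction.

Section TrivialRep.
Variables (K : fieldType) (N : nat) (A M : asshder K N).

Lemma trivial_rep_der (U V : lmodType K) (k : 'I_N.+1)
    (D : {linear M -> M}) (F : 'I_N.+1 -> U) (G : 'I_N.+1 -> V) u v :
  D (zero_action M (u : U) (v : V)) =
  \sum_(i < N.+1) \sum_(j < N.+1 | (i + j == k)%N) zero_action M (F i) (G j).
Proof. by rewrite linear0 !big1 // => i _; rewrite big1. Qed.

(* The product of M plays no role here: only its vector space and its maps. *)
Definition trivial_rep : rep A :=
  @Rep K N A M (@zero_action K A M M) (@zero_action K M A M)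
    (fun _ _ _ => erefl) (fun _ _ _ => erefl) (fun _ _ _ => erefl)
    (hder M) (proj1 (hderP M))
    (fun k a m => trivial_rep_der k _ (fun i => hder A i a)
                    (fun j => hder M j m) a m)
    (fun k m a => trivial_rep_der k _ (fun i => hder M i m)
                    (fun j => hder A j a) m a).
End TrivialRep.

(* Hom(U^{\otimes n}, V), encoded as the n-multilinear maps, where an n-tuple of
   vectors is a function on 'I_n. *)
Section Multilinear.
Variables (K : fieldType) (n : nat) (U V : lmodType K).

Definition upd (x : 'I_n -> U) (i : 'I_n) (u : U) : 'I_n -> U :=
  fun j => if j == i then u else x j.

Definition multilinear (f : ('I_n -> U) -> V) : Prop :=
  forall (x : 'I_n -> U) (i : 'I_n), linear (fun u : U => f (upd x i u)).

Definition multilinear_pred : {pred ('I_n -> U) -> V} :=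
  fun f => `[< multilinear f >].

Lemma multilinear0 : multilinear (fun=> 0).
Proof. by move=> x i a u v; rewrite scaler0 addr0. Qed.

Lemma multilinearD f g : multilinear f -> multilinear g ->
  multilinear (fun x => f x + g x).
Proof. by move=> fP gP x i a u v; rewrite fP gP scalerDr addrACA. Qed.

Lemma multilinearZ a f : multilinear f -> multilinear (fun x => a *: f x).
Proof.
by move=> fP x i b u v; rewrite fP !scalerDr !scalerA (mulrC a b).
Qed.

Lemma multilinearN f : multilinear f -> multilinear (fun x => - f x).
Proof. by move=> fP x i a u v; rewrite fP opprD scalerN. Qed.

Lemma multilinear_sum I (r : seq I) (P : pred I) F :
  (forall i, P i -> multilinear (F i)) ->
  multilinear (fun x => \sum_(i <- r | P i) F i x).
Proof.
move=> FP x j a u v; rewrite scaler_sumr -big_split /=.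
by apply: eq_bigr => i Pi; rewrite (FP i Pi).
Qed.

Lemma multilinear_lin (h : {linear V -> V}) f :
  multilinear f -> multilinear (fun x => h (f x)).
Proof. by move=> fP x i a u v; rewrite fP linearP. Qed.

Lemma multilinear_submod : submod_closed multilinear_pred.
Proof.
split=> [|a f g /asboolP fP /asboolP gP]; apply/asboolP.
  exact: multilinear0.
exact: multilinearD (multilinearZ a fP) gP.
Qed.
HB.instance Definition _ :=
  GRing.isSubmodClosed.Build K (('I_n -> U) -> V) multilinear_pred
    multilinear_submod.

Record multimap := Multimap {
  multimap_val :> ('I_n -> U) -> V;
  multimap_valP : multimap_val \in multilinear_pred }.
HB.instance Definition _ := [isSub for multimap_val].
HB.instance Definition _ := [Choice of multimap by <:].
HB.instance Definition _ := [SubChoice_isSubLmodule of multimap by <:].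

Definition mk_multimap f (fP : multilinear f) : multimap := Multimap (asboolT fP).

Lemma multimap_multilinear (f : multimap) : multilinear f.
Proof. exact: asboolW (multimap_valP f). Qed.

Lemma multimapP (f g : multimap) : (forall x, f x = g x) -> f = g.
Proof. by move=> fg; apply/val_inj/funext. Qed.
End Multilinear.

Section Complex.
Variables (K : fieldType) (N : nat) (A : asshder K N) (M : rep A).
Local Notation Hom n := (@multimap K n A M).

Section Degree.
Variable n : nat.
Implicit Types x : 'I_n.+1 -> A.

Definition args_tail x : 'I_n -> A := fun j => x (lift ord0 j).
Definition args_init x : 'I_n -> A := fun j => x (widen_ord (leqnSn n) j).

(* (x_0, ..., x_i x_{i+1}, ..., x_n); positions are counted from 0, which shifts
   by one the sign exponents in the coboundaries below. *)
Definition args_mul x (i : 'I_n) : 'I_n -> A := fun j =>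
  if (j < i)%N then x (widen_ord (leqnSn n) j)
  else if j == i then nmul A (x (widen_ord (leqnSn n) i)) (x (lift ord0 i))
  else x (lift ord0 j).

Definition hoch_fun (f : Hom n) x : M :=
  lact M (x ord0) (f (args_tail x))
  + \sum_(i < n) (-1) ^+ i.+1 *: f (args_mul x i)
  + (-1) ^+ n.+1 *: ract M (f (args_init x)) (x ord_max).

(* The component k : 'I_N of a tuple (f_1, ..., f_N) is f_{k+1}. *)
Definition hoch'_fun (fs : 'I_N -> Hom n) (k : 'I_N) x : M :=
  \sum_(i < N.+1) \sum_(j < N | (i + j.+1 == k.+1)%N)
    lact M (hder A i (x ord0)) (fs j (args_tail x))
  + \sum_(i < n) (-1) ^+ i.+1 *: fs k (args_mul x i)
  + (-1) ^+ n.+1 *: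
    \sum_(i < N) \sum_(j < N.+1 | (i.+1 + j == k.+1)%N)
      ract M (fs i (args_init x)) (hder A j (x ord_max)).

Definition hdelta_fun (k : 'I_N.+1) (f : Hom n) (x : 'I_n -> A) : M :=
  \sum_(d : {ffun 'I_n -> 'I_N.+1} | (\sum_(l < n) d l == k)%N)
    f (fun l => hder A (d l) (x l))
  - rep_der M k (f x).

Lemma upd_tail0 x u : args_tail (upd x ord0 u) = args_tail x.
Proof. by apply/funext => j; rewrite /args_tail /upd. Qed.

Lemma upd_tail x i u :
  args_tail (upd x (lift ord0 i) u) = upd (args_tail x) i u.
Proof.
by apply/funext => j; rewrite /args_tail /upd (inj_eq lift_inj).
Qed.

Lemma upd_init_max x u : args_init (upd x ord_max u) = args_init x.
Proof.
apply/funext => j; rewrite /args_init /upd -val_eqE /=.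
by rewrite (ltn_eqF (ltn_ord j)).
Qed.

Lemma upd_init x i u :
  args_init (upd x (widen_ord (leqnSn n) i) u) = upd (args_init x) i u.
Proof. by apply/funext => j; rewrite /args_init /upd -val_eqE. Qed.

Lemma lift0_or (i : 'I_n.+1) : i = ord0 \/ exists j, i = lift ord0 j.
Proof. by case: (unliftP ord0 i) => [j|] ->; [right; exists j | left]. Qed.

Lemma widen_or (i : 'I_n.+1) :
  i = ord_max \/ exists j : 'I_n, i = widen_ord (leqnSn n) j.
Proof.
have [lt_in|le_ni] := ltnP i n.
  by right; exists (Ordinal lt_in); apply/val_inj.
left; apply/val_inj/eqP => /=; rewrite eqn_leq le_ni andbT.
by rewrite -ltnS.
Qed.

Lemma multilinear_left (D : {linear A -> A}) (f : Hom n) :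
  multilinear (fun x => lact M (D (x ord0)) (f (args_tail x))).
Proof.
move=> x i a u v; case: (lift0_or i) => [->|[j ->]].
  by rewrite !upd_tail0 /upd eqxx linearP linearPl.
by rewrite !upd_tail /upd /= (multimap_multilinear f) linearPr.
Qed.

Lemma multilinear_right (D : {linear A -> A}) (f : Hom n) :
  multilinear (fun x => ract M (f (args_init x)) (D (x ord_max))).
Proof.
move=> x i a u v; case: (widen_or i) => [->|[j ->]].
  by rewrite !upd_init_max /upd eqxx linearP linearPr.
have jn : (ord_max == widen_ord (leqnSn n) j) = false.
  by rewrite -val_eqE /= gtn_eqF.
by rewrite !upd_init /upd jn (multimap_multilinear f) linearPl.
Qed.

Lemma multilinear_mul (f : Hom n) (i : 'I_n) :
  multilinear (fun x => f (args_mul x i)).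
Proof.
move=> x l a u v.
suff [j [g [gP gE]]] : exists (j : 'I_n) (g : A -> A), linear g /\
    forall w, args_mul (upd x l w) i = upd (args_mul x i) j (g w).
  by rewrite !gE gP (multimap_multilinear f).
have [lt_li|lt_il|/val_inj eq_li] := ltngtP l (widen_ord (leqnSn n) i).
- exists (Ordinal (ltn_trans lt_li (ltn_ord i))), id; split=> // w.
  apply/funext => j; rewrite /args_mul /upd -!val_eqE /= /bump /= !add1n.
  move: lt_li => /= lt_li.
  case: (ltngtP j i) => ji; case: (ltngtP j l) => jl;
    case: (ltngtP i l) => il; case: (ltngtP i.+1 l) => il';
    case: (ltngtP j.+1 l) => jl' //; exfalso;
    move: ji jl il il' jl' lt_li; lia.
- have [j lj] : exists j : 'I_n, l = lift ord0 j.
    by case: (lift0_or l) lt_il => [->|].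
  subst l; move: lt_il; rewrite /= /bump add1n ltnS leq_eqVlt.
  case/orP=> [/eqP/val_inj eq_ij|lt_ij].
    subst j; exists i, (fun w => nmul A (x (widen_ord (leqnSn n) i)) w).
    split=> [b w w'|w]; first by rewrite linearPr.
    apply/funext => j; rewrite /args_mul /upd -!val_eqE /= /bump /= !add1n.
    rewrite eqxx (ltn_eqF (ltnSn i)) !eqSS.
    by case: (ltngtP j i) => // ji; rewrite (ltn_eqF (leqW ji)).
  exists j, id; split=> // w.
  apply/funext => j'; rewrite /args_mul /upd -!val_eqE /= /bump /= !add1n !eqSS.
  case: (ltngtP j' i) => ji; case: (ltngtP j' j) => jl;
    case: (ltngtP i j) => il; case: (ltngtP i j.+1) => il';
    case: (ltngtP j' j.+1) => jl' //; exfalso;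
    move: ji jl il il' jl' lt_ij; lia.
- subst l; exists i, (fun w => nmul A w (x (lift ord0 i))).
  split=> [b w w'|w]; first by rewrite linearPl.
  apply/funext => j; rewrite /args_mul /upd -!val_eqE /= /bump /= !add1n.
  rewrite eqxx (gtn_eqF (ltnSn i)).
  by case: (ltngtP j i) => // ji; rewrite ?(ltn_eqF ji) ?(gtn_eqF (leqW ji)).
Qed.

Lemma hoch_multilinear f : multilinear (hoch_fun f).
Proof.
apply: multilinearD; first apply: multilinearD.
- exact: (multilinear_left (idfun : {linear A -> A})).
- apply: multilinear_sum => i _; apply: multilinearZ; exact: multilinear_mul.
- apply: multilinearZ; exact: (multilinear_right (idfun : {linear A -> A})).
Qed.

Lemma hoch'_multilinear fs k : multilinear (hoch'_fun fs k).
Proof.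
apply: multilinearD; first apply: multilinearD.
- do 2 apply: multilinear_sum => ? _; exact: multilinear_left.
- apply: multilinear_sum => i _; apply: multilinearZ; exact: multilinear_mul.
- apply: multilinearZ.
  do 2 apply: multilinear_sum => ? _; exact: multilinear_right.
Qed.

Lemma hdelta_multilinear k f : multilinear (hdelta_fun k f).
Proof.
apply: multilinearD; last first.
  apply: multilinearN; apply: multilinear_lin; exact: multimap_multilinear.
apply: multilinear_sum => d _ x i a u v.
have E w : (fun l => hder A (d l) (upd x i w l)) =
    upd (fun l => hder A (d l) (x l)) i (hder A (d i) w).
  by apply/funext => j; rewrite /upd; case: eqP => // ->.
by rewrite !E linearP (multimap_multilinear f).
Qed.

Definition hoch (f : Hom n) : Hom n.+1 := mk_multimap (hoch_multilinear f).
Definition hoch' (fs : {ffun 'I_N -> Hom n}) (k : 'I_N) : Hom n.+1 :=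
  mk_multimap (hoch'_multilinear fs k).
Definition hdelta (k : 'I_N.+1) (f : Hom n) : Hom n :=
  mk_multimap (hdelta_multilinear k f).

Lemma addr3B (V : zmodType) (a b c a' b' c' : V) :
  (a - a') + (b - b') + (c - c') = a + b + c - (a' + b' + c').
Proof.
by rewrite opprD [RHS]addrACA opprD; congr (_ + _); rewrite [RHS]addrACA.
Qed.

Lemma subrACA (V : zmodType) (a b a' b' : V) :
  (a - a') - (b - b') = (a - b) - (a' - b').
Proof. by rewrite !opprB addrACA [in RHS]addrACA [- a' + _]addrC. Qed.

Lemma hoch_is_zmod_morphism : zmod_morphism hoch.
Proof.
move=> f g; apply/multimapP => x.
rewrite [LHS]/(hoch_fun _ _) [RHS]/(hoch_fun f x - hoch_fun g x).
rewrite /hoch_fun; apply: etrans (addr3B _ _ _ _ _ _); congr (_ + _ + _).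
- exact: linearBr.
- by rewrite -sumrB; apply: eq_bigr => i _; rewrite -scalerBr.
- by rewrite -scalerBr -linearBl.
Qed.

Lemma hoch'_is_zmod_morphism k : zmod_morphism (hoch' ^~ k).
Proof.
move=> f g; apply/multimapP => x.
rewrite [LHS]/(hoch'_fun _ _ _) [RHS]/(hoch'_fun f k x - hoch'_fun g k x).
rewrite /hoch'_fun; apply: etrans (addr3B _ _ _ _ _ _); congr (_ + _ + _).
- rewrite -sumrB; apply: eq_bigr => i _; rewrite -sumrB.
  by apply: eq_bigr => j _; rewrite !ffunE -linearBr.
- by rewrite -sumrB; apply: eq_bigr => i _; rewrite -scalerBr !ffunE.
- rewrite -scalerBr -sumrB; congr (_ *: _); apply: eq_bigr => i _.
  by rewrite -sumrB; apply: eq_bigr => j _; rewrite !ffunE -linearBl.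
Qed.

Lemma hdelta_is_zmod_morphism k : zmod_morphism (hdelta k).
Proof.
move=> f g; apply/multimapP => x.
rewrite [LHS]/(hdelta_fun _ _ _) [RHS]/(hdelta_fun k f x - hdelta_fun k g x).
rewrite /hdelta_fun [X in rep_der M k X]/(f x - g x) linearB.
apply: etrans (subrACA _ _ _ _); congr (_ - _).
by rewrite -sumrB.
Qed.
End Degree.

(* 'rV[K]_0 is the zero space. *)
Definition cochain (n : nat) : lmodType K :=
  match n with
  | 0 => 'rV[K]_0
  | 1 => Hom 1
  | n'.+2 => (Hom n'.+2 * {ffun 'I_N -> Hom n'.+1})%type
  end.

Definition differential (n : nat) : cochain n -> cochain n.+1 :=
  match n return cochain n -> cochain n.+1 with
  | 0 => fun _ => 0
  | 1 => fun f => (hoch f, [ffun k => - hdelta (lift ord0 k) f])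
  | n'.+2 => fun c =>
      (hoch c.1,
       [ffun k => hoch' c.2 k + (-1) ^+ n'.+2 *: hdelta (lift ord0 k) c.1])
  end.

Lemma differential_is_zmod_morphism n : zmod_morphism (@differential n).
Proof.
case: n => [|[|n]] f g /=; first by rewrite subr0.
  congr pair; first exact: hoch_is_zmod_morphism.
  apply/ffunP => k; rewrite !ffunE hdelta_is_zmod_morphism.
  by rewrite opprB opprK addrC.
congr pair; first exact: hoch_is_zmod_morphism.
apply/ffunP => k; rewrite !ffunE hdelta_is_zmod_morphism.
by rewrite hoch'_is_zmod_morphism scalerBr opprD addrACA.
Qed.
HB.instance Definition _ n :=
  GRing.isZmodMorphism.Build (cochain n) (cochain n.+1) (@differential n)
    (@differential_is_zmod_morphism n).

Definition cocycle_pred n : {pred cochain n} :=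
  fun c => `[< differential c = 0 >].

Lemma cocycle_zmod n : zmod_closed (@cocycle_pred n).
Proof.
split=> [|c c' /asboolP cP /asboolP c'P]; apply/asboolP; first exact: raddf0.
by rewrite raddfB [X in X - _]cP [X in _ - X]c'P subr0.
Qed.
HB.instance Definition _ n :=
  GRing.isZmodClosed.Build (cochain n) (@cocycle_pred n) (@cocycle_zmod n).

Record cocycle n := Cocycle { cocycle_val :> cochain n;
                              cocycle_valP : cocycle_val \in @cocycle_pred n }.
HB.instance Definition _ n := [isSub for @cocycle_val n].
HB.instance Definition _ n := [Choice of cocycle n by <:].
HB.instance Definition _ n := [SubChoice_isSubZmodule of cocycle n by <:].

Definition coboundary n : {pred cocycle n} :=
  match n return {pred cocycle n} with
  | 0 => fun c => c == 0
  | n'.+1 => fun c => `[< exists b : cochain n', cocycle_val c = differential b >]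
  end.

Lemma coboundary_zmod n : zmod_closed (@coboundary n).
Proof.
case: n => [|n]; split.
- exact: eqxx.
- by move=> x y /eqP-> /eqP->; rewrite unfold_in /= subr0.
- by apply/asboolP; exists 0; rewrite raddf0.
- move=> x y /asboolP[b xb] /asboolP[c yc]; apply/asboolP; exists (b - c).
  by rewrite raddfB [LHS](raddfB val) [X in X - _]xb [X in _ - X]yc.
Qed.
HB.instance Definition _ n :=
  GRing.isZmodClosed.Build (cocycle n) (@coboundary n) (@coboundary_zmod n).

Definition cohomology (n : nat) : zmodType := Quotient.quot (@coboundary n).
Definition coh_class n (c : cocycle n) : cohomology n := \pi_(cohomology n)%qT c.
End Complex.

Section CentralExtension.
Variables (K : fieldType) (N : nat).

Definition is_trivial (M : asshder K N) : Prop :=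
  forall m m' : M, nmul M m m' = 0.

Variables (A M : asshder K N).

Record central_ext := CentralExt {
  ext_alg :> asshder K N;
  ext_i : asshder_hom M ext_alg;
  ext_p : asshder_hom ext_alg A;
  ext_i_inj : injective ext_i;
  ext_exact : forall e : ext_alg, ext_p e = 0 <-> exists m : M, ext_i m = e;
  ext_p_surj : forall a : A, exists e : ext_alg, ext_p e = a;
  ext_central : forall (m : M) (e : ext_alg),
    nmul ext_alg (ext_i m) e = 0 /\ nmul ext_alg e (ext_i m) = 0 }.

Definition ext_iso (E E' : central_ext) : Prop :=
  exists eta : asshder_hom E E',
    [/\ bijective eta, forall m, eta (ext_i E m) = ext_i E' m
      & forall e, ext_p E' (eta e) = ext_p E e].

(* Classes are predicates rather than elements of a MathComp quotient type:
   [central_ext] lives in a universe above that of the vector spaces. *)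
Definition ext_classes : Type :=
  {X : central_ext -> Prop | exists E, X = ext_iso E}.

Definition ext_class (E : central_ext) : ext_classes :=
  exist _ (ext_iso E) (ex_intro _ E erefl).

Definition is_section (E : central_ext) (s : {linear A -> E}) : Prop :=
  forall a, ext_p E (s a) = a.

(* [c] is (psi; chi_1, ..., chi_N): the identification of M with i(M) is made
   explicit, and determines [c] since i is injective. *)
Definition section_cochain (E : central_ext) (s : {linear A -> E})
    (c : cochain (trivial_rep A M) 2) : Prop :=
  (forall x : 'I_2 -> A,
     ext_i E (c.1 x) =
     nmul E (s (x ord0)) (s (x ord_max)) - s (nmul A (x ord0) (x ord_max))) /\
  (forall (k : 'I_N) (x : 'I_1 -> A),
     ext_i E (c.2 k x) =
     hder E (lift ord0 k) (s (x ord0)) - s (hder A (lift ord0 k) (x ord0))).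
End CentralExtension.

(* Main.v *)
(* A section s writes every element of an extension uniquely as i(m) + s(a), and
   since i(M) annihilates the algebra, all the structure is then determined by
   (psi; chi_1, ..., chi_N): extensions with sections having the same cocycle are
   isomorphic via i(m) + s(a) |-> i'(m) + s'(a). The sections of one extension are
   the s + i f with f : A -> M linear, and replacing s by s + i f adds the
   coboundary of f to the cocycle; an isomorphism carries sections to sections
   with the same cocycle. So the cohomology class is a complete invariant, and it
   takes every value since a cocycle twists the structure of A (+) M. *)
Require Import Defs.
From HB Require Import structures.
From mathcomp Require Import all_boot all_order all_algebra.
From mathcomp Require Import all_classical.

Set Implicit Arguments.
Unset Strict Implicit.
Unset Printing Implicit Defensive.

Import GRing.Theory.
Local Open Scope ring_scope.

(** * Linear algebra in arbitrary dimension: bundled maps and linear sections *)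

(** Bundles maps whose linearity is only known propositionally, as happens for functions obtained by
    choice. *)
Lemma linear_exists (K : fieldType) (U V : lmodType K) (f : U -> V) :
  linear f -> exists g : {linear U -> V}, g =1 f.
Proof.
move=> fP; pose fL := GRing.isLinear.Build K U V _ f fP.
by exists (HB.pack_for {linear U -> V} f fL).
Qed.

Lemma bilinear_exists (K : fieldType) (U V W : lmodType K) (f : U -> V -> W) :
  (forall v, linear (f ^~ v)) -> (forall u, linear (f u)) ->
  exists g : {bilinear U -> V -> W}, forall u v, g u v = f u v.
Proof.
move=> fPl fPr.
have fP : bilinear_for (GRing.Scale.Law.clone _ _ *:%R _)
    (GRing.Scale.Law.clone _ _ *:%R _) f by split=> *; [exact: fPl|exact: fPr].
pose fL := bilinear_isBilinear.Build K U V W _ _ f fP.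
by exists (HB.pack_for {bilinear U -> V -> W} f fL).
Qed.

(** Zorn's lemma on the subspaces meeting the kernel trivially: if a maximal one missed some [v],
    adjoining a preimage of [v] would enlarge it. *)
Lemma ker_complement_exists (K : fieldType) (U V : lmodType K)
    (p : {linear U -> V}) : (forall v, exists u, p u = v) ->
  exists W : U -> Prop,
    [/\ forall c u u', W u -> W u' -> W (c *: u + u'),
        forall u, W u -> p u = 0 -> u = 0
      & forall v, exists2 u, W u & p u = v].
Proof.
move=> p_surj.
(* P does not ask that W contain 0: the union of the empty chain is empty. *)
pose P (W : U -> Prop) := (forall c u u', W u -> W u' -> W (c *: u + u')) /\
  (forall u, W u -> p u = 0 -> u = 0).
have [W [[Wlin W0] Wmax]] : exists W : set U,
    P W /\ forall B : set U, (W `<` B)%classic -> ~ P B.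
  apply: (@Zorn_bigcup U P) => F FP Ftot; split.
    move=> c u u' [X FX Xu] [Y FY Yu'].
    have [XY|YX] := Ftot X Y FX FY.
      by exists Y => //; apply: (proj1 (FP _ FY)) => //; exact: XY.
    by exists X => //; apply: (proj1 (FP _ FX)) => //; exact: YX.
  by move=> u [X FX Xu]; exact: (proj2 (FP _ FX)).
(* A [W] without 0 is empty, because [- u + u] lies in it for each of its elements [u]; then the
   zero subspace is strictly larger. *)
have W00 : W 0.
  apply: contrapT => nW0.
  have noW u : ~ W u.
    by move=> Wu; apply: nW0; rewrite -(addNr u) -scaleN1r; exact: Wlin.
  apply: (Wmax (eq^~ 0)); first by split=> [u /noW|/(_ _ erefl)].
  by split=> [c u u' -> ->|//]; rewrite scaler0 addr0.
have WZ c u : W u -> W (c *: u).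
  by move=> Wu; rewrite -[_ *: _]addr0; exact: Wlin.
exists W; split=> // v; apply: contrapT => vW.
have [e ev] := p_surj v.
pose B u := exists c w, W w /\ u = c *: e + w.
have WB : (W `<` B)%classic.
  split=> [u Wu|/(_ e) BW]; first by exists 0, u; rewrite scale0r add0r.
  apply: vW; exists e => //; apply: BW.
  by exists 1, 0; rewrite scale1r addr0.
apply: (Wmax B WB); split=> [c u u' [d [w [Ww ->]]] [d' [w' [Ww' ->]]]|u].
  exists (c * d + d'), (c *: w + w'); split; first exact: Wlin.
  by rewrite scalerDr scalerA scalerDl addrACA.
move=> [c [w [Ww ->]]]; rewrite linearD linearZ ev => /= pu0.
have [c0|c0] := eqVneq c 0.
  by move: pu0; rewrite c0 !scale0r !add0r; exact: W0.
(* Here [p w = - (c *: v)] with [c] nonzero, so rescaling [w] gives a preimage of [v] inside [W]. *)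
case: vW; exists (- c^-1 *: w); first exact: WZ.
have /eqP := pu0; rewrite addrC addr_eq0 => /eqP pw.
by rewrite linearZ /= pw scalerN scaleNr opprK scalerA mulVf ?scale1r.
Qed.

(** On a complement of the kernel [p] is injective, so preimages chosen there are unique and
    therefore depend linearly on [v]. *)
Lemma linear_section_exists (K : fieldType) (U V : lmodType K)
    (p : {linear U -> V}) : (forall v, exists u, p u = v) ->
  exists s : {linear V -> U}, forall v, p (s v) = v.
Proof.
move=> /ker_complement_exists[W [Wlin W0 Wp]].
have /choice[f fP] v : exists u, W u /\ p u = v.
  by have [u Wu pu] := Wp v; exists u.
have W_inj u u' : W u -> W u' -> p u = p u' -> u = u'.
  move=> Wu Wu' puu'; apply/eqP; rewrite -subr_eq0; apply/eqP/W0.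
    by rewrite addrC -scaleN1r; exact: Wlin.
  by rewrite linearB /= puu' subrr.
have [s sf] : exists s : {linear V -> U}, s =1 f.
  apply: linear_exists => c v v'; apply: W_inj.
  - exact: (proj1 (fP _)).
  - by apply: Wlin; exact: (proj1 (fP _)).
  - by rewrite linearP !(proj2 (fP _)).
by exists s => v; rewrite sf (proj2 (fP v)).
Qed.

(** * Finite sums, and argument tuples written as lists *)

Lemma sum_pair (U V : nmodType) I (r : seq I) (P : pred I)
    (f : I -> U) (g : I -> V) :
  \sum_(i <- r | P i) ((f i, g i) : U * V) =
  (\sum_(i <- r | P i) f i, \sum_(i <- r | P i) g i).
Proof. by elim/big_rec3: _ => // i x y z _ ->. Qed.

Lemma sum_ord_eq0 (V : nmodType) n (F : 'I_n.+1 -> 'I_n.+1 -> V) :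
  \sum_(i < n.+1) \sum_(j < n.+1 | (i + j == 0)%N) F i j = F ord0 ord0.
Proof.
rewrite (bigD1 ord0) //= (big_pred1 ord0) => [|j]; last by rewrite add0n.
rewrite big1 ?addr0 // => i; rewrite -val_eqE => /negPf i0.
by rewrite big_pred0 // => j; rewrite addn_eq0 i0.
Qed.

Section Args.
Variable V : nmodType.

(** The default value 0 of [nth] is never reached when [s] has length [n], the only case used. *)
Definition args n (s : seq V) : 'I_n -> V := fun i => s`_i.

Lemma args1E (x : 'I_1 -> V) : x = args [:: x ord0].
Proof. by apply/funext => i; rewrite (ord1 i). Qed.

Lemma args2E (x : 'I_2 -> V) : x = args [:: x ord0; x ord_max].
Proof.
by apply/funext => -[[|[|i]] ltn2] //; rewrite /args /=; congr x; exact/val_inj.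
Qed.

Lemma args3E (x : 'I_3 -> V) :
  x = args [:: x ord0; x (lift ord0 ord0); x ord_max].
Proof.
by apply/funext => -[[|[|[|i]]] ltn3] //; rewrite /args /=; congr x; exact/val_inj.
Qed.

End Args.

Section Multimaps.
Variables (K : fieldType) (U V : lmodType K).

Lemma multimap1_exists (f : U -> V) : linear f ->
  exists F : multimap 1 U V, forall x, F x = f (x ord0).
Proof.
move=> fP; have FP : multilinear (fun x : 'I_1 -> U => f (x ord0)).
  by move=> x i c u v; rewrite /upd (ord1 i) fP.
by exists (mk_multimap FP).
Qed.

Lemma multimap2_exists (f : U -> U -> V) :
  (forall v, linear (f ^~ v)) -> (forall u, linear (f u)) ->
  exists F : multimap 2 U V, forall x, F x = f (x ord0) (x ord_max).
Proof.
move=> fPl fPr.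
have FP : multilinear (fun x : 'I_2 -> U => f (x ord0) (x ord_max)).
  move=> x [[|[|i]] ltn2] c u v //=; rewrite /upd /=; first exact: fPl.
  exact: fPr.
by exists (mk_multimap FP).
Qed.
End Multimaps.

(** * The differential in degrees one and two with trivial coefficients *)

Section Cochains.
Variables (K : fieldType) (N : nat) (A M : asshder K N).
Local Notation R := (trivial_rep A M).
Implicit Types (a b : A).
Local Notation arg1 a := (@args A 1 [:: a]).
Local Notation arg2 a b := (@args A 2 [:: a; b]).

(** The two outer terms of the coboundary are zero actions; only the term with a merged argument
    survives. *)
Lemma hoch1E (f : multimap 1 A R) a b :
  hoch f (arg2 a b) = - f (arg1 (nmul A a b)).
Proof.
rewrite [LHS]/(hoch_fun _ _) /hoch_fun big_ord1 add0r scaler0 addr0 scaleN1r.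
by congr (- f _); apply/funext => i; rewrite (ord1 i).
Qed.

Lemma hoch2E (f : multimap 2 A R) a b c :
  hoch f (args [:: a; b; c]) =
  f (arg2 a (nmul A b c)) - f (arg2 (nmul A a b) c).
Proof.
rewrite [LHS]/(hoch_fun _ _) /hoch_fun !big_ord_recl big_ord0 add0r scaler0.
rewrite !addr0 scaleN1r sqrrN expr1n scale1r addrC.
by congr (f _ - f _); rewrite [LHS]args2E.
Qed.

Lemma hoch'1E (fs : {ffun 'I_N -> multimap 1 A R}) (k : 'I_N) a b :
  hoch' fs k (arg2 a b) = - fs k (arg1 (nmul A a b)).
Proof.
rewrite [LHS]/(hoch'_fun _ _ _) /hoch'_fun big_ord1.
rewrite big1 => [|i _]; last by rewrite big1.
rewrite [X in _ + _ + _ *: X]big1 => [|i _]; last by rewrite big1.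
rewrite add0r scaler0 addr0 scaleN1r.
by congr (- fs k _); apply/funext => i; rewrite (ord1 i).
Qed.

Lemma hdelta1E (f : multimap 1 A R) (k : 'I_N.+1) a :
  hdelta k f (arg1 a) = f (arg1 (hder A k a)) - hder M k (f (arg1 a)).
Proof.
rewrite [LHS]/(hdelta_fun _ _ _) /hdelta_fun; congr (_ - _).
(* The constant [k] is the only index function on ['I_1] with sum [k]. *)
rewrite (bigD1 [ffun=> k]) /=; last by rewrite big_ord1 ffunE.
rewrite big1 ?addr0 => [|d /andP[]].
  by congr (f _); rewrite [LHS]args1E ffunE.
rewrite big_ord1 => /eqP/val_inj dk /eqP[]; apply/ffunP => i.
by rewrite (ord1 i) ffunE.
Qed.

Lemma hdelta2E (f : multimap 2 A R) (k : 'I_N.+1) a b :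
  hdelta k f (arg2 a b) =
  \sum_(i < N.+1) \sum_(j < N.+1 | (i + j == k)%N)
    f (arg2 (hder A i a) (hder A j b)) - hder M k (f (arg2 a b)).
Proof.
rewrite [LHS]/(hdelta_fun _ _ _) /hdelta_fun; congr (_ - _).
rewrite pair_big_dep /=.
(* Index functions on ['I_2] correspond to pairs of indices. *)
rewrite (reindex (fun q : 'I_N.+1 * 'I_N.+1 =>
  [ffun l : 'I_2 => if l == ord0 then q.1 else q.2])) /=; last first.
  exists (fun d : {ffun 'I_2 -> 'I_N.+1} => (d ord0, d ord_max)).
    by move=> [i j] _; rewrite !ffunE.
  move=> d _; apply/ffunP => l; rewrite ffunE.
  by case: l => [[|[|l]] ltl] //=; congr (d _); exact/val_inj.
apply: eq_big => [[i j]|[i j] _].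
  by rewrite big_ord_recl big_ord1 !ffunE.
by congr (f _); rewrite [LHS]args2E !ffunE.
Qed.

(** The first equation amounts to associativity of the twisted product on A (+) M, the second to the
    Leibniz rule of the twisted maps. *)
Definition is_cocycle2 (c : cochain R 2) : Prop :=
  (forall a b e, c.1 (arg2 (nmul A a b) e) = c.1 (arg2 a (nmul A b e))) /\
  forall (k : 'I_N) a b,
    \sum_(i < N.+1) \sum_(j < N.+1 | (i + j == lift ord0 k)%N)
      c.1 (arg2 (hder A i a) (hder A j b)) =
    hder M (lift ord0 k) (c.1 (arg2 a b)) + c.2 k (arg1 (nmul A a b)).

Lemma cocycle2P (c : cochain R 2) : differential c = 0 <-> is_cocycle2 c.
Proof.
split=> [dc0|[cA cD]].
  have [dc1 dc2] := (congr1 fst dc0, congr1 snd dc0).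
  split=> [a b e|k a b].
    have /(congr1 (fun f : multimap 3 A R => f (args [:: a; b; e]))) := dc1.
    by rewrite hoch2E => /subr0_eq.
  have /ffunP/(_ k) := dc2; rewrite !ffunE sqrrN expr1n scale1r.
  move=> /(congr1 (fun f : multimap 2 A R => f (arg2 a b))).
  rewrite [LHS]/(hoch' _ _ _ + hdelta _ _ _) hoch'1E hdelta2E.
  by move=> /(canRL (addNKr _))/(canRL (subrK _)) ->; rewrite addr0 addrC.
congr pair.
  by apply/multimapP => x; rewrite (args3E x) hoch2E cA subrr.
apply/ffunP => k; rewrite !ffunE sqrrN expr1n scale1r.
apply/multimapP => x; rewrite (args2E x).
rewrite [LHS]/(hoch' _ _ _ + hdelta _ _ _) hoch'1E hdelta2E cD.
by apply: (canLR (addKr _)); rewrite [RHS]addr0 addrC addKr.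
Qed.

(** This is the shape in which a change of section modifies psi and the chi_k. *)
Lemma differential1E (c : cochain R 2) (f : cochain R 1) :
  c = differential f <->
  (forall a b, c.1 (arg2 a b) = - f (arg1 (nmul A a b))) /\
  forall (k : 'I_N) a, c.2 k (arg1 a) =
    hder M (lift ord0 k) (f (arg1 a)) - f (arg1 (hder A (lift ord0 k) a)).
Proof.
split=> [->|[c1 c2]].
  split=> [a b|k a]; first exact: hoch1E.
  by rewrite /= ffunE -opprB -hdelta1E.
case: c c1 c2 => c1 c2 /= c1E c2E; congr pair.
  by apply/multimapP => x; rewrite (args2E x) hoch1E c1E.
apply/ffunP => k; rewrite ffunE; apply/multimapP => x; rewrite (args1E x).
by rewrite c2E -opprB -hdelta1E.
Qed.

(** Equality in the quotient means that the difference is a coboundary; the additive form matches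
    the effect of changing a section. *)
Lemma coh_class_eq n (z z' : cocycle R n.+1) :
  coh_class z = coh_class z' <->
  exists f : cochain R n, cocycle_val z = cocycle_val z' + differential f.
Proof.
split=> [/eqquotP/asboolP[f zz']|[f zz']].
  by exists f; rewrite -zz' [X in _ + X](raddfB val) addrC subrK.
apply/eqquotP/asboolP; exists f; rewrite [LHS](raddfB val) [X in X - _]zz'.
by rewrite [X in X - _]addrC addrK.
Qed.
End Cochains.

(** * Sections of a central extension and their cocycles *)

Section ExtensionTheory.
Variables (K : fieldType) (N : nat) (A M : asshder K N).
Local Notation R := (trivial_rep A M).
Local Notation arg1 a := (@args A 1 [:: a]).
Local Notation arg2 a b := (@args A 2 [:: a; b]).
Implicit Types (E : central_ext A M) (c : cochain R 2) (f : cochain R 1).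

(** Multilinearity is stated through [upd]; the linear slot is recovered by overwriting an entry 0
    of an explicit tuple. The next two lemmas do the same for each of two slots. *)
Lemma multimap1_linear f : linear (fun a => f (arg1 a) : M).
Proof.
move=> k a b; have := multimap_multilinear f (arg1 0) ord0 k a b.
have E u : upd (arg1 0) ord0 u = arg1 u.
  by rewrite [LHS]args1E.
by rewrite /= !E.
Qed.

Lemma multimap2_linearl (g : multimap 2 A R) b :
  linear (fun a => g (arg2 a b) : M).
Proof.
move=> k a a'; have := multimap_multilinear g (arg2 0 b) ord0 k a a'.
have E u : upd (arg2 0 b) ord0 u = arg2 u b by rewrite [LHS]args2E.
by rewrite /= !E.
Qed.

Lemma multimap2_linearr (g : multimap 2 A R) a :
  linear (fun b => g (arg2 a b) : M).
Proof.
move=> k b b'; have := multimap_multilinear g (arg2 a 0) ord_max k b b'.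
have E u : upd (arg2 a 0) ord_max u = arg2 a u by rewrite [LHS]args2E.
by rewrite /= !E.
Qed.

Lemma section_cochainE E (s : {linear A -> E}) c : section_cochain s c <->
  (forall a b, ext_i E (c.1 (arg2 a b)) = nmul E (s a) (s b) - s (nmul A a b)) /\
  (forall (k : 'I_N) a, ext_i E (c.2 k (arg1 a)) =
     hder E (lift ord0 k) (s a) - s (hder A (lift ord0 k) a)).
Proof.
split=> [[c1 c2]|[c1 c2]]; first by split=> *; rewrite ?c1 ?c2.
split=> [x|k x]; first by rewrite [in LHS](args2E x) c1.
by rewrite [in LHS](args1E x) c2.
Qed.

Lemma ext_piE E m : ext_p E (ext_i E m) = 0.
Proof. by apply/(ext_exact (c := E)); exists m. Qed.

Lemma ext_mulD E m m' (e e' : E) :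
  nmul E (ext_i E m + e) (ext_i E m' + e') = nmul E e e'.
Proof.
rewrite linearDl !linearDr !(proj1 (ext_central _ _)).
by rewrite (proj2 (ext_central _ _)) !add0r.
Qed.

Lemma ext_section_exists E : exists s : {linear A -> E}, is_section s.
Proof. exact: linear_section_exists (@ext_p_surj _ _ _ _ E). Qed.

Section FixedSection.
Variables (E : central_ext A M) (s : {linear A -> E}).
Hypothesis sP : is_section s.

(** The right-hand side is killed by [ext_p], hence comes from [M] by exactness; injectivity of
    [ext_i] makes the choice unique and so linear. *)
Lemma ext_retraction_exists :
  exists r : {linear E -> M}, forall e, ext_i E (r e) = e - s (ext_p E e).
Proof.
have /choice[r rP] e : exists m, ext_i E m = e - s (ext_p E e).
  by apply/(ext_exact (c := E)); rewrite linearB /= sP subrr.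
have [r' rr'] : exists r' : {linear E -> M}, r' =1 r.
  apply: linear_exists => k e e'; apply: (@ext_i_inj _ _ _ _ E).
  by rewrite linearP !rP /= !linearP /= scalerDr addrACA.
by exists r' => e; rewrite rr'.
Qed.

Lemma ext_split e : exists m, e = ext_i E m + s (ext_p E e).
Proof.
by have [r rP] := ext_retraction_exists; exists (r e); rewrite rP subrK.
Qed.

(** Products depend only on the images of the factors in [A]. This allows a factor [s (nmul A a b)]
    to be exchanged for [nmul E (s a) (s b)]. *)
Lemma ext_mulE e e' : nmul E e e' = nmul E (s (ext_p E e)) (s (ext_p E e')).
Proof.
have [[m em] [m' em']] := (ext_split e, ext_split e').
by rewrite {1}em {1}em' ext_mulD.
Qed.

Lemma section_cocycle_exists :
  exists z : cocycle R 2, section_cochain s (cocycle_val z).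
Proof.
have [r rP] := ext_retraction_exists.
(* Applying [r] to [e] subtracts [s (ext_p E e)] and reads the result in [M]; on products and
   derivatives of values of [s] this gives psi and chi_k. *)
have [psi psiP] : exists psi : multimap 2 A R,
    forall x, psi x = r (nmul E (s (x ord0)) (s (x ord_max))).
  apply: (multimap2_exists (f := fun a b => r (nmul E (s a) (s b)))).
    by move=> b k a a'; rewrite !linearP linearPl linearP.
  by move=> a k b b'; rewrite !linearP.
have /choice[chi chiP] (k : 'I_N) : exists chi : multimap 1 A R,
    forall x, chi x = r (hder E (lift ord0 k) (s (x ord0))).
  apply: (multimap1_exists (f := fun a => r (hder E (lift ord0 k) (s a)))).
  by move=> l a a'; rewrite !linearP.
pose c : cochain R 2 := (psi, [ffun k => chi k]).
have cP : section_cochain s c.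
  split=> [x|k x] /=; rewrite ?ffunE ?psiP ?chiP rP; congr (_ - s _).
    by rewrite hom_mul !sP.
  by rewrite -hom_der sP.
have [c1 c2] := proj1 (section_cochainE _ _) cP.
suff cc : c \in @cocycle_pred _ _ _ R 2 by exists (Cocycle cc).
apply/asboolP/cocycle2P; split=> [a b e|k a b]; apply: (@ext_i_inj _ _ _ _ E).
  rewrite !c1 nmulA; congr (_ - _).
  rewrite [LHS]ext_mulE [RHS]ext_mulE !sP.
  transitivity (nmul E (nmul E (s a) (s b)) (s e)).
    by rewrite [RHS]ext_mulE hom_mul !sP.
  by rewrite -nmulA [LHS]ext_mulE hom_mul !sP.
(* The two terms with the derivation of [s (nmul A a b)] cancel. The Leibniz rules of [E] and [A]
   are then expanded and compared term by term. *)
rewrite [RHS]linearD /= -hom_der c1 c2 linearB /= addrA subrK.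
rewrite !(proj2 (hderP _)) [LHS]linear_sum [X in _ - X]linear_sum -sumrB.
apply: eq_bigr => i _; rewrite [LHS]linear_sum [X in _ - X]linear_sum -sumrB.
apply: eq_bigr => j _; rewrite /= c1.
by congr (_ - _); rewrite [RHS]ext_mulE -!hom_der !sP.
Qed.

Lemma section_cochain_unique c c' :
  section_cochain s c -> section_cochain s c' -> c = c'.
Proof.
case: c c' => [c1 c2] [c1' c2'] [/= c1P c2P] [/= c1P' c2P']; congr pair.
  by apply/multimapP => x; apply: (@ext_i_inj _ _ _ _ E); rewrite c1P c1P'.
apply/ffunP => k; apply/multimapP => x.
by apply: (@ext_i_inj _ _ _ _ E); rewrite c2P c2P'.
Qed.

(** By [ext_mulD] the product of two section values is unchanged, so psi moves only through
    [s' (nmul A a b)]; chi_k moves by the commutator of [f] with the k-th maps. *)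
Lemma section_cochainD (s' : {linear A -> E}) f c :
  (forall a, s' a = s a + ext_i E (f (arg1 a))) ->
  section_cochain s c -> section_cochain s' (c + differential f).
Proof.
move=> s'E /section_cochainE[c1 c2].
have [df1 df2] := proj1 (differential1E (differential f) f) erefl.
apply/section_cochainE; split=> [a b|k a].
  have -> : (c + differential f).1 (arg2 a b) =
      c.1 (arg2 a b) - f (arg1 (nmul A a b)) :> M by rewrite -df1.
  rewrite linearB /= c1 !s'E ![s _ + _]addrC ext_mulD.
  by rewrite [ext_i E _ + _]addrC opprD addrA.
have -> : (c + differential f).2 k (arg1 a) =
    c.2 k (arg1 a) + (hder M (lift ord0 k) (f (arg1 a)) -
                      f (arg1 (hder A (lift ord0 k) a))) :> M.
  by rewrite -df2 [(c + _).2]/(c.2 + (differential f).2) ffunE.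
rewrite linearD linearB /= c2 !s'E linearD /= hom_der.
by rewrite opprD addrACA.
Qed.

Lemma section_adjust f :
  exists2 s' : {linear A -> E}, is_section s' &
    forall a, s' a = s a + ext_i E (f (arg1 a)).
Proof.
have [s' s'E] : exists s' : {linear A -> E},
    s' =1 fun a => s a + ext_i E (f (arg1 a)).
  apply: linear_exists => k a b; rewrite multimap1_linear !linearP.
  by rewrite scalerDr addrACA.
by exists s' => // a; rewrite s'E linearD /= ext_piE addr0 sP.
Qed.

Lemma section_diff (s' : {linear A -> E}) : is_section s' ->
  exists f : cochain R 1, forall a, s' a = s a + ext_i E (f (arg1 a)).
Proof.
move=> s'P; have [r rP] := ext_retraction_exists.
(* The retraction [r] measures the deviation from [s], so composing it with [s'] yields the
   difference of the sections. *)
have [f fE] : exists f : multimap 1 A R, forall x, f x = r (s' (x ord0)).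
  apply: (multimap1_exists (f := fun a => r (s' a))) => k a b.
  by rewrite !linearP.
by exists f => a; rewrite fE rP s'P addrC subrK.
Qed.
End FixedSection.

(** * Isomorphism of extensions against equality of cohomology classes *)

(** The new section is [s] followed by the isomorphism, which fixes the copy of [M] and hence the
    cochain. *)
Lemma ext_iso_section_cochain E E' (s : {linear A -> E}) c :
    ext_iso E E' -> is_section s -> section_cochain s c ->
  exists2 s' : {linear A -> E'}, is_section s' & section_cochain s' c.
Proof.
move=> [eta [_ eta_i eta_p]] sP [c1 c2].
have [s' s'E] : exists s' : {linear A -> E'}, s' =1 fun a => eta (s a).
  by apply: linear_exists => k a b; rewrite !linearP.
exists s' => [a|]; first by rewrite s'E eta_p sP.
split=> [x|k x]; rewrite -eta_i ?c1 ?c2 linearB /= !s'E ?hom_mul //.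
by rewrite hom_der.
Qed.

(** Only a homomorphism is built here; exchanging the two extensions supplies its inverse in
    [same_cochain_iso]. *)
Lemma same_cochain_hom E E' (s : {linear A -> E}) (s' : {linear A -> E'}) c :
    is_section s -> is_section s' ->
    section_cochain s c -> section_cochain s' c ->
  exists eta : asshder_hom E E',
    forall m a, eta (ext_i E m + s a) = ext_i E' m + s' a.
Proof.
move=> sP s'P /section_cochainE[c1 c2] /section_cochainE[c1' c2'].
have [r rP] := ext_retraction_exists sP.
have riE m a : r (ext_i E m + s a) = m.
  by apply: (@ext_i_inj _ _ _ _ E); rewrite rP linearD /= ext_piE sP add0r addrK.
have [eta etaE] : exists eta : {linear E -> E'},
    eta =1 fun e => ext_i E' (r e) + s' (ext_p E e).
  by apply: linear_exists => k e e'; rewrite !linearP scalerDr addrACA.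
have eta_is m a : eta (ext_i E m + s a) = ext_i E' m + s' a.
  by rewrite etaE riE linearD /= ext_piE sP add0r.
have eta_mul a b : eta (nmul E a b) = nmul E' (eta a) (eta b).
  have [[m ->] [n ->]] := (ext_split sP a, ext_split sP b).
  rewrite !eta_is !ext_mulD.
  move: (ext_p E a) (ext_p E b) => {}a {}b.
  (* The product of [s a] and [s b] is split as [ext_i] of psi plus [s (nmul A a b)], a form on
     which [eta] is known. *)
  by rewrite -[LHS](congr1 eta (subrK (s (nmul A a b)) _)) -c1 eta_is c1' subrK.
have eta_der (k : 'I_N.+1) e : hder E' k (eta e) = eta (hder E k e).
  (* A cochain carries chi_k only for positive indices; at index 0 both maps are the identity. *)
  case: (unliftP ord0 k) => [j|] ->; last by rewrite !(proj1 (hderP _)).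
  have [m ->] := ext_split sP e; move: (ext_p E e) => a.
  rewrite eta_is [hder E' _ _]linearD [hder E _ _]linearD /= !hom_der.
  rewrite -(subrK (s (hder A (lift ord0 j) a)) (hder E (lift ord0 j) (s a))).
  rewrite -c2 addrA -[ext_i E _ + ext_i E _]linearD eta_is linearD /= c2'.
  by rewrite -addrA subrK.
by exists (AssHDerHom eta_mul eta_der).
Qed.

Lemma same_cochain_iso E E' (s : {linear A -> E}) (s' : {linear A -> E'}) c :
    is_section s -> is_section s' ->
    section_cochain s c -> section_cochain s' c ->
  ext_iso E E'.
Proof.
move=> sP s'P cP cP'.
have [eta etaE] := same_cochain_hom sP s'P cP cP'.
have [eta' eta'E] := same_cochain_hom s'P sP cP' cP.
exists eta; split.
- exists eta' => e.
    by have [m ->] := ext_split sP e; rewrite etaE eta'E.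
  by have [m ->] := ext_split s'P e; rewrite eta'E etaE.
- by move=> m; have := etaE m 0; rewrite !linear0 !addr0.
- move=> e; have [m em] := ext_split sP e.
  by rewrite {1}em etaE linearD /= ext_piE s'P add0r.
Qed.

(** Forwards, a section carried over to [E'] differs from [s'] by some [f], and cochains of a
    section are unique. Backwards, shifting [s'] by [f] gives both extensions the same cochain. *)
Lemma ext_iso_coh_class E E' (s : {linear A -> E}) (s' : {linear A -> E'})
    (z z' : cocycle R 2) :
    is_section s -> is_section s' ->
    section_cochain s (cocycle_val z) -> section_cochain s' (cocycle_val z') ->
  ext_iso E E' <-> coh_class z = coh_class z'.
Proof.
move=> sP s'P zP zP'; rewrite coh_class_eq; split=> [EE'|[f zz']].
  have [t tP tz] := ext_iso_section_cochain EE' sP zP.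
  have [f fE] := section_diff s'P tP.
  by exists f; apply: section_cochain_unique tz (section_cochainD fE zP').
have [t tP tE] := section_adjust s'P f.
by apply: same_cochain_iso sP tP zP _; rewrite zz'; exact: section_cochainD.
Qed.

End ExtensionTheory.

(** * Realising a cocycle by a twisted extension *)

Section TwistedExtension.
Variables (K : fieldType) (N : nat) (A M : asshder K N).
Local Notation R := (trivial_rep A M).
Local Notation arg1 a := (@args A 1 [:: a]).
Local Notation arg2 a b := (@args A 2 [:: a; b]).

(* The extension is A (+) M with product (a, m)(b, n) = (ab, psi(a, b)) and maps
   (a, m) |-> (d_k a, d_k m + chi_k a), where chi_0 = 0. *)
Lemma cocycle_extension_exists (c : cochain R 2) : is_trivial M ->
  is_cocycle2 c ->
  exists (E : central_ext A M) (s : {linear A -> E}),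
    is_section s /\ section_cochain s c.
Proof.
move=> M0 [cA cD].
pose V : lmodType K := (A * M)%type.
have [mul mulE] : exists mul : {bilinear V -> V -> V},
    forall x y : V, mul x y = (nmul A x.1 y.1, c.1 (arg2 x.1 y.1)).
  apply: (bilinear_exists
    (f := fun x y : V => (nmul A x.1 y.1, c.1 (arg2 x.1 y.1)) : V)).
    by move=> y k x x'; rewrite linearPl multimap2_linearl.
  by move=> x k y y'; rewrite linearPr multimap2_linearr.
have mulA : associative mul by move=> x y z; rewrite !mulE /= nmulA cA.
pose chi (k : 'I_N.+1) a : M :=
  if unlift ord0 k is Some j then c.2 j (arg1 a) else 0.
have chi_lin k : linear (chi k).
  move=> l a b; rewrite /chi; case: (unlift ord0 k) => [j|].
    exact: multimap1_linear.
  by rewrite scaler0 addr0.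
have /choice[d dE] (k : 'I_N.+1) : exists d : {linear V -> V},
    forall x, d x = (hder A k x.1, hder M k x.2 + chi k x.1).
  apply: (@linear_exists K V V
    (fun x => (hder A k x.1, hder M k x.2 + chi k x.1) : V)).
  move=> l x y; rewrite [chi k _]chi_lin /= !linearP.
  by congr pair; rewrite /= scalerDr addrACA.
pose E0 := NAlgebra mulA.
have dP : @higher_derivation K N E0 d.
  split=> [[a m]|k x y].
    by rewrite dE !(proj1 (hderP _)) /chi unlift_none addr0.
  rewrite [LHS]dE [nmul _ _ _]mulE /=.
  (* The product ignores the [M] components, so neither the maps of [M] nor chi enter the right-hand
     side. *)
  have -> : \sum_(i < N.+1) \sum_(j < N.+1 | (i + j == k)%N)
      nmul E0 (d i x) (d j y) =
    (\sum_(i < N.+1) \sum_(j < N.+1 | (i + j == k)%N)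
       nmul A (hder A i x.1) (hder A j y.1),
     \sum_(i < N.+1) \sum_(j < N.+1 | (i + j == k)%N)
       c.1 (arg2 (hder A i x.1) (hder A j y.1))).
    rewrite -sum_pair; apply: eq_bigr => i _; rewrite -sum_pair.
    by apply: eq_bigr => j _; rewrite [LHS]mulE !dE.
  rewrite -(proj2 (hderP _)); congr pair.
  case: (unliftP ord0 k) => [j|] ->; last first.
    by rewrite sum_ord_eq0 !(proj1 (hderP _)) /chi unlift_none addr0.
  by rewrite cD /chi liftK.
pose E1 := AssHDer dP.
have [i iE] : exists i : {linear M -> E1}, forall m, i m = (0, m) :> V.
  apply: (@linear_exists K M V (fun m => (0, m))) => k m m'.
  by congr pair; rewrite /= scaler0 addr0.
have [p pE] : exists p : {linear E1 -> A}, forall x : V, p x = x.1.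
  exact: (@linear_exists K V A fst).
have [s sE] : exists s : {linear A -> E1}, forall a, s a = (a, 0) :> V.
  apply: (@linear_exists K A V (fun a => (a, 0))) => k a a'.
  by congr pair; rewrite /= scaler0 addr0.
have chi0 k : chi k 0 = 0 := linear0 (HB.pack_for {linear A -> M} (chi k)
  (GRing.isLinear.Build K A M _ (chi k) (chi_lin k))).
have c10l b : c.1 (arg2 0 b) = 0 :> M.
  (* Linearity with scalar -1 and both vectors 0 writes the value as minus itself plus itself. *)
  by have := multimap2_linearl c.1 b (-1) 0 0; rewrite scaler0 addr0 scaleN1r addNr.
have c10r b : c.1 (arg2 b 0) = 0 :> M.
  by have := multimap2_linearr c.1 b (-1) 0 0; rewrite scaler0 addr0 scaleN1r addNr.
(* Triviality of [M] enters here: elements (0, m) multiply to zero in the extension. *)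
have i_mul m m' : i (nmul M m m') = nmul E1 (i m) (i m').
  by rewrite [RHS]mulE M0 !iE /= c10l linear0.
have i_der k m : hder E1 k (i m) = i (hder M k m).
  by rewrite [LHS]dE !iE /= chi0 addr0 linear0.
have p_mul x y : p (nmul E1 x y) = nmul A (p x) (p y).
  by rewrite [nmul E1 _ _]mulE !pE.
have p_der k x : hder A k (p x) = p (hder E1 k x) by rewrite [hder E1 _ _]dE !pE.
have i_inj : injective i by move=> m m'; rewrite !iE => -[].
have ip_exact e : p e = 0 <-> exists m, i m = e.
  split=> [|[m <-]]; last by rewrite iE pE.
  by case: e => a m; rewrite pE /= => ->; exists m; rewrite iE.
have p_surj a : exists e, p e = a by exists (s a); rewrite sE pE.
have i_central m e : nmul E1 (i m) e = 0 /\ nmul E1 e (i m) = 0.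
  by rewrite ![nmul E1 _ _]mulE iE /= c10l c10r linear0l linear0r.
pose E := @CentralExt K N A M E1 (AssHDerHom i_mul i_der)
  (AssHDerHom p_mul p_der) i_inj ip_exact p_surj i_central.
exists E, s; split=> [a|]; first by rewrite [LHS]pE sE.
apply/(section_cochainE (E := E)); split=> [a b|k a].
  rewrite [LHS]iE [nmul E1 _ _]mulE !sE.
  by congr pair; rewrite /= ?subrr ?subr0.
rewrite [LHS]iE [hder E1 _ _]dE !sE /chi liftK.
by congr pair; rewrite /= ?subrr ?subr0 // linear0 add0r.
Qed.
End TwistedExtension.

(** * The induced bijection on isomorphism classes *)

Theorem theorem4p4 (K : fieldType) (charK : [pchar K] =i pred0)
    (N : nat) (N_ge1 : (1 <= N)%N)
    (A M : asshder K N) (M_trivial : is_trivial M) :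
  exists Phi : ext_classes A M -> cohomology (trivial_rep A M) 2,
    (forall E : central_ext A M,
       (exists s : {linear A -> E}, is_section s) /\
       (forall s : {linear A -> E}, is_section s ->
          exists z : cocycle (trivial_rep A M) 2,
            section_cochain s (cocycle_val z) /\
            Phi (ext_class E) = coh_class z)) /\
    bijective Phi.
Proof.
(* A relation avoids fixing sections in advance; [cls_iso] then shows both that it is single-valued
   and that it separates isomorphism classes. *)
pose cls (E : central_ext A M) h := exists (s : {linear A -> E})
  (z : cocycle (trivial_rep A M) 2),
  [/\ is_section s, section_cochain s (cocycle_val z) & h = coh_class z].
have cls_iso (E E' : central_ext A M) h h' :
    cls E h -> cls E' h' -> ext_iso E E' <-> h = h'.
  move=> [s [z [sP zP ->]]] [s' [z' [s'P zP' ->]]].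
  exact: ext_iso_coh_class zP zP'.
have cls_ex E : exists h, cls E h.
  have [s sP] := ext_section_exists E.
  have [z zP] := section_cocycle_exists sP.
  by exists (coh_class z), s, z.
have iso_refl (E : central_ext A M) : ext_iso E E.
  by have [h hE] := cls_ex E; apply/(cls_iso _ _ _ _ hE hE).
have class_eq (E E' : central_ext A M) :
    ext_class E = ext_class E' <-> ext_iso E E'.
  split=> [[->]//|EE'].
  (* Symmetry and transitivity of [ext_iso] are inherited from equality of cohomology classes. *)
  have XX' : ext_iso E = ext_iso E'.
    have [[h hE] [h' hE']] := (cls_ex E, cls_ex E').
    have hh' := proj1 (cls_iso _ _ _ _ hE hE') EE'.
    apply/funext => F; apply/propext; have [g gF] := cls_ex F.
    by rewrite (cls_iso _ _ _ _ hE gF) (cls_iso _ _ _ _ hE' gF) hh'.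
  exact: eq_exist.
have class_surj X : exists E, X = ext_class E :> ext_classes A M.
  by case: X => X [E XE]; exists E; apply: eq_exist.
(* The chosen [h] must serve every representative of [X], which makes [Phi] usable on any
   [ext_class E]. *)
have /choice[Phi PhiP] (X : ext_classes A M) :
    exists h, forall E, X = ext_class E -> cls E h.
  have [E0 ->] := class_surj X; have [h hE0] := cls_ex E0.
  exists h => E /class_eq EE0; have [h' hE] := cls_ex E.
  by rewrite (proj1 (cls_iso _ _ _ _ hE0 hE) EE0).
exists Phi; split=> [E|].
  split=> [|s sP]; first exact: ext_section_exists.
  have [z zP] := section_cocycle_exists sP; exists z; split=> //.
  (* Comparing [E] with itself gives independence of the section. *)
  apply/(cls_iso E E); [exact: PhiP | by exists s, z | exact: iso_refl].
have cls_surj h : exists E, cls E h.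
  have [z ->] : exists z, h = coh_class z.
    by exists (repr h); rewrite /coh_class reprK.
  have /asboolP/cocycle2P zc := cocycle_valP z.
  have [E [s [sP sz]]] := cocycle_extension_exists M_trivial zc.
  by exists E, s, z.
have /choice[F FP] := cls_surj.
(* The inverse sends [h] to the class of an extension chosen to realise it. *)
exists (fun h => ext_class (F h)) => [X|h].
  have [E XE] := class_surj X; rewrite [RHS]XE; apply/class_eq.
  exact/(cls_iso _ _ _ _ (FP _) (PhiP _ _ XE)).
apply/(cls_iso _ _ _ _ (PhiP _ _ erefl) (FP h)); exact: iso_refl.
Qed.
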